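(* Let $n\ge 1$. The assignment $$\Gamma:\ J_{\mathfrak{sp}(2n,\mathbb C)}\to J_{2n},\qquad s_{[p,q]}\mapsto s'_{[p,q]}:=s_{[p,q]}\,s_{[2n-q,2n-p]}\ (1\le p\le q<n),\qquad s_{[p,n]}\mapsto s_{[p,2n-p]}\ (1\le p\le n),$$ defines an injective group homomorphism.
   Context: Intervals $[p,q]=\{p,p+1,\dots,q\}$ with $p\le q$ are viewed as connected sub-diagrams of a Dynkin diagram. A union $J\sqcup J'$ of two sub-diagrams is disconnected if no node of $J$ equals or is adjacent to a node of $J'$. The cactus group $J_{2n}=J_{\mathfrak{sl}(2n,\mathbb C)}$ is the group with generators $s_{[p,q]}$, $[p,q]\subseteq[2n-1]$, and relations: (1A) $s_J^2=1$; (2A) $s_Js_{J'}=s_{J'}s_J$ if $J\sqcup J'$ is disconnected; (3A) $s_{[p,q]}s_{[k,l]}=s_{[p+q-l,p+q-k]}s_{[p,q]}$ for $[k,l]\subset[p,q]\subseteq[2n-1]$. The symplectic cactus group $J_{\mathfrak{sp}(2n,\mathbb C)}$ is the group with generators $s_{[p,q]}$, $[p,q]\subseteq[n]$, and relations: (1C) $s_J^2=1$; (2C) $s_Js_{J'}=s_{J'}s_J$ if $J\sqcup J'$ is disconnected in $[n]$; (3C) (i) $s_{[p,n]}s_{[k,l]}=s_{[k,l]}s_{[p,n]}$ for $[k,l]\subseteq[p,n]\subseteq[n]$, and (ii) $s_{[p,q]}s_{[k,l]}=s_{[p+q-l,p+q-k]}s_{[p,q]}$ for $[k,l]\subseteq[p,q]\subseteq[n-1]$.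 *)

(* Defs.v *)
From HB Require Import structures.
From mathcomp Require Import all_boot boolp.

Set Implicit Arguments.
Unset Strict Implicit.
Unset Printing Implicit Defensive.

Local Open Scope quotient_scope.

(* (x, false) is the letter x and (x, true) its formal inverse. *)
Definition word (X : Type) : Type := seq (X * bool).

Definition word_inv (X : Type) (u : word X) : word X :=
  rev [seq (a.1, ~~ a.2) | a <- u].

Section Presentation.

Variables (X : choiceType) (R : word X -> word X -> Prop).

Inductive word_cong : word X -> word X -> Prop :=
| word_cong_rel u v : R u v -> word_cong u v
| word_cong_cancel x b : word_cong [:: (x, b); (x, ~~ b)] [::]
| word_cong_refl u : word_cong u u
| word_cong_sym u v : word_cong u v -> word_cong v u
| word_cong_trans u v w : word_cong u v -> word_cong v w -> word_cong u w
| word_cong_cat u u' v v' :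
    word_cong u u' -> word_cong v v' -> word_cong (u ++ v) (u' ++ v').

(* The word problem being undecidable in general, the boolean relation
   required by the quotient construction is obtained classically. *)
Definition word_congb (u v : word X) : bool := `[< word_cong u v >].

Lemma word_congb_refl : reflexive word_congb.
Proof. by move=> u; apply/asboolP/word_cong_refl. Qed.

Lemma word_congb_sym : symmetric word_congb.
Proof.
by move=> u v; apply/asboolP/asboolP => h; apply: word_cong_sym.
Qed.

Lemma word_congb_trans : transitive word_congb.
Proof.
move=> v u w /asboolP uv /asboolP vw; apply/asboolP.
exact: word_cong_trans uv vw.
Qed.

Canonical word_congb_equiv :=
  EquivRel word_congb word_congb_refl word_congb_sym word_congb_trans.

(* The group presented by the generators X and the relations u = v for R u v. *)
Definition presented := {eq_quot word_congb}.

HB.instance Definition _ := Choice.on presented.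
HB.instance Definition _ := EqQuotient.on presented.

Definition to_presented (u : word X) : presented := \pi_presented u.

Lemma to_presentedP u v : to_presented u = to_presented v <-> word_cong u v.
Proof.
by split=> [/eqmodP/asboolP | uv] //; apply/eqmodP/asboolP.
Qed.

Definition presented_mul (g h : presented) : presented :=
  to_presented (repr g ++ repr h).
Definition presented_inv (g : presented) : presented :=
  to_presented (word_inv (repr g)).
Definition presented_one : presented := to_presented [::].

Lemma reprK_presented (g : presented) : to_presented (repr g) = g.
Proof. exact: reprK. Qed.

Lemma repr_cong u : word_cong (repr (to_presented u)) u.
Proof. by apply/to_presentedP; rewrite reprK_presented. Qed.

Lemma to_presentedM u v :
  presented_mul (to_presented u) (to_presented v) = to_presented (u ++ v).
Proof. by apply/to_presentedP/word_cong_cat; apply: repr_cong. Qed.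

Lemma word_invK : involutive (@word_inv X).
Proof.
move=> u; rewrite /word_inv map_rev revK -map_comp -[RHS]map_id.
by apply: eq_map => -[x b] /=; rewrite negbK.
Qed.

Lemma word_invV u : word_cong (u ++ word_inv u) [::].
Proof.
elim: u => [|[x b] u IHu]; first exact: word_cong_refl.
have -> : ((x, b) :: u) ++ word_inv ((x, b) :: u)
    = [:: (x, b)] ++ (u ++ word_inv u) ++ [:: (x, ~~ b)].
  by rewrite /word_inv /= rev_cons -cats1 catA.
apply: word_cong_trans (word_cong_cancel x b).
apply: (word_cong_cat (word_cong_refl _)).
exact: (word_cong_cat IHu (word_cong_refl _)).
Qed.

Lemma word_invl u : word_cong (word_inv u ++ u) [::].
Proof. by have := word_invV (word_inv u); rewrite word_invK. Qed.

Lemma presented_mulA : associative presented_mul.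
Proof.
move=> g h k.
by rewrite -(reprK_presented g) -(reprK_presented h) -(reprK_presented k)
  !to_presentedM catA.
Qed.

Lemma presented_mul1x : left_id presented_one presented_mul.
Proof. by move=> g; rewrite -(reprK_presented g) to_presentedM. Qed.

Lemma presented_mulx1 : right_id presented_one presented_mul.
Proof. by move=> g; rewrite -(reprK_presented g) to_presentedM cats0. Qed.

Lemma presented_mulVx :
  left_inverse presented_one presented_inv presented_mul.
Proof.
move=> g; rewrite -[X in presented_mul _ X]reprK_presented to_presentedM.
exact/to_presentedP/word_invl.
Qed.

Lemma presented_mulxV :
  right_inverse presented_one presented_inv presented_mul.
Proof.
move=> g; rewrite -[X in presented_mul X _]reprK_presented to_presentedM.
exact/to_presentedP/word_invV.
Qed.

HB.instance Definition _ := isGroup.Build presented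
  presented_mulA presented_mul1x presented_mulx1 presented_mulVx presented_mulxV.

End Presentation.

(* [p, q] is a (nonempty) interval contained in [m] = {1, ..., m}. *)
Definition is_itv (m p q : nat) : bool := [&& 0 < p, p <= q & q <= m].

Definition itv (m : nat) := {pq : nat * nat | is_itv m pq.1 pq.2}.

(* The generator s_[p,q]. The default (empty word) is only there to make the
   function total: it is returned when is_itv m p q fails. *)
Definition s_word (m p q : nat) : word (itv m) :=
  if (insub (p, q) : option (itv m)) is Some J then [:: (J, false)] else [::].

(* In the Dynkin diagrams of types A and C, with their standard numbering,
   two nodes are adjacent exactly when their labels are consecutive. *)
Definition adjacent (i j : nat) : bool := (i.+1 == j) || (j.+1 == i).

Definition disconnected (p q k l : nat) : Prop :=
  forall i j : nat, p <= i <= q -> k <= j <= l ->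
    i <> j /\ ~~ adjacent i j.

Inductive sl_rel (m : nat) : word (itv m) -> word (itv m) -> Prop :=
| sl_square p q :
    is_itv m p q ->
    sl_rel (s_word m p q ++ s_word m p q) [::]
| sl_commute p q k l :
    is_itv m p q -> is_itv m k l -> disconnected p q k l ->
    sl_rel (s_word m p q ++ s_word m k l) (s_word m k l ++ s_word m p q)
| sl_flip p q k l :
    is_itv m p q -> [&& p <= k, k <= l & l <= q] ->
    sl_rel (s_word m p q ++ s_word m k l)
           (s_word m (p + q - l) (p + q - k) ++ s_word m p q).

Inductive sp_rel (n : nat) : word (itv n) -> word (itv n) -> Prop :=
| sp_square p q :
    is_itv n p q ->
    sp_rel (s_word n p q ++ s_word n p q) [::]
| sp_commute p q k l :
    is_itv n p q -> is_itv n k l -> disconnected p q k l ->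
    sp_rel (s_word n p q ++ s_word n k l) (s_word n k l ++ s_word n p q)
| sp_central p k l :
    is_itv n p n -> [&& p <= k, k <= l & l <= n] ->
    sp_rel (s_word n p n ++ s_word n k l) (s_word n k l ++ s_word n p n)
| sp_flip p q k l :
    is_itv n.-1 p q -> [&& p <= k, k <= l & l <= q] ->
    sp_rel (s_word n p q ++ s_word n k l)
           (s_word n (p + q - l) (p + q - k) ++ s_word n p q).

(* The cactus group J_N of sl(N, C), whose Dynkin diagram is [N - 1]. *)
Definition cactus_sl (N : nat) : groupType := presented (@sl_rel N.-1).

(* The cactus group of sp(2n, C), whose Dynkin diagram is [n]. *)
Definition cactus_sp (n : nat) : groupType := presented (@sp_rel n).

Definition sl_gen (N p q : nat) : cactus_sl N :=
  to_presented (@sl_rel N.-1) (s_word N.-1 p q).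

Definition sp_gen (n p q : nat) : cactus_sp n :=
  to_presented (@sp_rel n) (s_word n p q).

(* Main.v *)
Require Import Defs.
From HB Require Import structures.
From mathcomp Require Import all_boot.
From mathcomp Require Import order ssralg ssrnum ssrint.
From mathcomp Require Import boolp classical_sets.
From mathcomp Require Import zify.

Set Implicit Arguments.
Unset Strict Implicit.
Unset Printing Implicit Defensive.

Local Open Scope group_scope.

(** The cactus group on 2n strands acts on weights, that is, on integer
valued functions of the sets of strands: [s_[p,q]] reverses the strands of the
block [{p, ..., q+1}] and then applies the reflection [reflection A] attached to
that block [A]. These reflections are those of the (dual) geometric
representation of the right-angled Coxeter group which has one generator for
each set of strands, two of them commuting exactly when the sets are laminar,
i.e. nested or disjoint; the bilinear form is -1 on the other pairs.

The folding map is well defined because its images satisfy the symplectic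
relations. To see that it is injective, let [f] be the weight obtained from the
constant weight 1 by applying the image of a word of shortest length. Two
properties of [f] persist when a letter is added:
- the values of [f] on two sets that are not laminar have a positive sum; the
  reflection in [A] preserves this as soon as [f A > 0]
  ([crossing_positive_reflection]);
- [f] is invariant under the mirror symmetry of the 2n strands, since the image
  of each symplectic generator is.
They give the descent property of [reduced_weight]: if [f] is not positive on
the block of a generator [s], then the word can be rewritten, without changing
its length, so as to begin with [s]. Indeed, when the word begins with
another letter [t], [f] is negative on the block of [t], so the blocks of [s] and [t] are laminar, and
then a defining relation has the form [t s' = s t'], where the value of [f] on
the block of [s] is the value on the block of [s'] of the weight of the rest of
the word ([sp_exchange]); induction applies to this rest.

Consequently, in a shortest word [t w] the weight of [w] is positive on the block
of [t], for otherwise [w] could begin with [t] and two letters would cancel.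
Hence the weight of [t w] is negative on that block: it is not the constant 1, and
the image of the word acts nontrivially. *)

(** * Actions of presented groups *)

(** The signs of the letters are forgotten: this is the action of a word when
every generator acts by an involution. *)
Definition word_act (X : choiceType) (S : Type) (act : X -> S -> S)
    (u : word X) (s : S) : S :=
  foldr (fun a => act a.1) s u.

Lemma word_act_cat (X : choiceType) (S : Type) (act : X -> S -> S) u v s :
  word_act act (u ++ v) s = word_act act u (word_act act v s).
Proof. by rewrite /word_act foldr_cat. Qed.

Lemma word_cong_act (X : choiceType) (R : word X -> word X -> Prop)
    (S : Type) (act : X -> S -> S) :
  (forall x, involutive (act x)) ->
  (forall u v, R u v -> word_act act u =1 word_act act v) ->
  forall u v, word_cong R u v -> word_act act u =1 word_act act v.
Proof.
move=> actK actR u v; elim=> {u v} //=.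
- by move=> x b s; rewrite /= actK.
- by move=> u v _ IH s; rewrite IH.
- by move=> u v w _ IHuv _ IHvw s; rewrite IHuv IHvw.
- by move=> u u' v v' _ IHu _ IHv s; rewrite !word_act_cat IHv IHu.
Qed.

(** The action goes through a chosen representative word; [presented_actE] says
that, for involutions satisfying the relations, the choice does not matter. *)
Definition presented_act (X : choiceType) (R : word X -> word X -> Prop)
    (S : Type) (act : X -> S -> S) (g : presented R) (s : S) : S :=
  word_act act (repr g) s.

Lemma presented_actE (X : choiceType) (R : word X -> word X -> Prop)
    (S : Type) (act : X -> S -> S) :
  (forall x, involutive (act x)) ->
  (forall u v, R u v -> word_act act u =1 word_act act v) ->
  forall u, presented_act act (to_presented R u) =1 word_act act u.
Proof. by move=> actK actR u; apply: word_cong_act (repr_cong R u). Qed.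

Lemma presented_actM (X : choiceType) (R : word X -> word X -> Prop)
    (S : Type) (act : X -> S -> S) :
  (forall x, involutive (act x)) ->
  (forall u v, R u v -> word_act act u =1 word_act act v) ->
  forall (g h : presented R) s,
    presented_act act (g * h) s = presented_act act g (presented_act act h s).
Proof.
by move=> actK actR g h s; rewrite [LHS]presented_actE // word_act_cat.
Qed.

(** * Reversals of intervals of strands *)

(** The node [i] of the diagram of type A joins the strands [i] and [i.+1], so
the interval [[p, q]] moves the strands [p] to [q.+1]. *)
Definition block (p q : nat) : set nat :=
  [set i | (p <= i <= q.+1)%N]%classic.

Definition flip (p q i : nat) : nat :=
  if (p <= i <= q.+1)%N then (p + q.+1 - i)%N else i.

Definition laminar (A B : set nat) : Prop :=
  (A `<=` B \/ B `<=` A \/ forall i, A i -> ~ B i)%classic.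

Lemma laminar_sym A B : laminar A B -> laminar B A.
Proof. by case=> [|[|AB]]; [right; left | left | right; right => i Bi /AB]. Qed.

Lemma laminar_refl A : laminar A A.
Proof. by left. Qed.

Lemma flipK p q : involutive (flip p q).
Proof. by rewrite /flip => i; do 2?[case: ifP]; lia. Qed.

Lemma flipC p q k l : (q.+1 < k)%N ->
  flip p q \o flip k l =1 flip k l \o flip p q.
Proof. by rewrite /flip /= => qk i /=; do 4?[case: ifP]; lia. Qed.

Lemma flip_flip p q k l : (p <= k)%N -> (k <= l)%N -> (l <= q)%N ->
  flip p q \o flip k l =1 flip (p + q - l) (p + q - k) \o flip p q.
Proof. by rewrite /flip /= => pk kl lq i /=; do 4?[case: ifP]; lia. Qed.

Lemma flip_block_disjoint p q k l : (q.+1 < k)%N || (l.+1 < p)%N ->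
  (flip p q @^-1` block k l = block k l)%classic.
Proof.
move=> H; apply/funext => i; apply/propext; rewrite /preimage /flip /block /=.
by case: ifP; lia.
Qed.

Lemma flip_block_sup p q k l : (k <= p)%N -> (q <= l)%N ->
  (flip p q @^-1` block k l = block k l)%classic.
Proof.
move=> *; apply/funext => i; apply/propext; rewrite /preimage /flip /block /=.
by case: ifP; lia.
Qed.

Lemma flip_block_sub p q k l : (p <= k)%N -> (k <= l)%N -> (l <= q)%N ->
  (flip p q @^-1` block k l = block (p + q - l) (p + q - k))%classic.
Proof.
move=> *; apply/funext => i; apply/propext; rewrite /preimage /flip /block /=.
by case: ifP; lia.
Qed.

(** For intervals of strands the overlap of two non-laminar ones is visible on
the extreme strands alone. The disjointness of blocks is the disconnectedness
of the sub-diagrams, not merely their disjointness. *)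
Lemma laminar_block p q k l : (p <= q)%N -> (k <= l)%N ->
  laminar (block p q) (block k l) <->
  [|| (q.+1 < k)%N, (l.+1 < p)%N, (k <= p)%N && (q <= l)%N
    | (p <= k)%N && (l <= q)%N].
Proof.
rewrite /laminar /block => pq kl; split; last first.
  case/or4P => H; [right; right|right; right|left|right; left] => i /=; lia.
(* Each inclusion is tested on extreme strands, and disjointness on first ones. *)
case=> [sub|[sub|dis]].
- by move: (sub p) (sub q.+1) => /=; lia.
- by move: (sub k) (sub l.+1) => /=; lia.
- by move: (dis p) (dis k) => /=; lia.
Qed.

Lemma laminar_preimage s A B : involutive s ->
  (laminar (s @^-1` A) (s @^-1` B) <-> laminar A B)%classic.
Proof.
move=> sK; rewrite /laminar /preimage /=; split.
  case=> [H|[H|H]]; [left|right; left|right; right] => i;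
  by have := H (s i); rewrite /= sK.
by case=> [H|[H|H]]; [left|right; left|right; right] => i /= /H.
Qed.

Lemma eq_block p q k l : (p <= q)%N -> (k <= l)%N ->
  block p q = block k l -> p = k /\ q = l.
Proof.
rewrite /block => pq kl E.
have H i : (p <= i <= q.+1)%N <-> (k <= i <= l.+1)%N.
  by have := congr1 (fun C : set nat => C i) E => /= ->.
by move: (H p) (H k) (H q.+1) (H l.+1); lia.
Qed.

(** * Reflections acting on weights *)

Definition weight := set nat -> int.

(** This is the action of a simple reflection on the coordinates of a vector of
the dual geometric representation of a right-angled Coxeter group: [f B] is the
pairing of the vector with the simple root of [B], and the form is 1 on the
diagonal, 0 on commuting pairs and -1 on the others. *)
Definition reflection (A : set nat) (f : weight) : weight := fun B =>
  if `[< B = A >] then (- f A)%R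
  else if `[< laminar A B >] then f B else (f B + f A + f A)%R.

Definition pull (s : nat -> nat) (f : weight) : weight :=
  fun B => f (s @^-1` B)%classic.

Lemma reflection_self A f : reflection A f A = (- f A)%R.
Proof. by rewrite /reflection asboolT. Qed.

Lemma reflection_laminar A B f : B <> A -> laminar A B ->
  reflection A f B = f B.
Proof. by move=> BA AB; rewrite /reflection asboolF // asboolT. Qed.

Lemma reflection_crossing A B f : ~ laminar A B ->
  reflection A f B = (f B + f A + f A)%R.
Proof.
move=> AB; rewrite /reflection !asboolF // => E; apply: AB.
by rewrite E; apply: laminar_refl.
Qed.

Lemma reflectionK A : involutive (reflection A).
Proof.
move=> f; apply/funext => B.
have [->|BA] := EM (B = A); first by rewrite !reflection_self; lia.
have [AB|AB] := EM (laminar A B); first by rewrite !reflection_laminar.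
by rewrite !(reflection_crossing _ AB) reflection_self; lia.
Qed.

Lemma reflectionC A A' f : laminar A A' ->
  reflection A (reflection A' f) = reflection A' (reflection A f).
Proof.
move=> AA'; have [<- //|neq] := EM (A = A').
have neq' : A' <> A by move/esym.
have A'A := laminar_sym AA'.
have fA' := reflection_laminar f neq' AA'.
have fA := reflection_laminar f neq A'A.
apply/funext => B.
have [->|BA] := EM (B = A).
  by rewrite (reflection_laminar _ neq A'A) !reflection_self fA.
have [->|BA'] := EM (B = A').
  by rewrite (reflection_laminar _ neq' AA') !reflection_self fA'.
have [AB|AB] := EM (laminar A B); have [A'B|A'B] := EM (laminar A' B).
- by rewrite !reflection_laminar.
- by rewrite (reflection_laminar _ BA AB) !(reflection_crossing _ A'B) fA'
    (reflection_laminar _ BA AB).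
- by rewrite (reflection_laminar _ BA' A'B) !(reflection_crossing _ AB) fA
    (reflection_laminar _ BA' A'B).
- by rewrite !(reflection_crossing _ AB, reflection_crossing _ A'B) fA fA'; lia.
Qed.

Lemma eq_pull s t f : s =1 t -> pull s f = pull t f.
Proof. by move=> /funext ->. Qed.

(** Permuting the strands preserves laminarity, hence normalises the Coxeter
group; this is what makes the semidirect product with permutations act. *)
Lemma reflection_pull s A f : involutive s ->
  reflection A (pull s f) = pull s (reflection (s @^-1` A)%classic f).
Proof.
move=> sK; apply/funext => B; rewrite /reflection /pull.
have -> : `[< B = A >] = `[< s @^-1` B = s @^-1` A >]%classic.
  apply/asbool_equiv_eq; split=> [-> //|E]; apply/funext => i.
  by have := congr1 (fun C : set nat => C (s i)) E; rewrite /preimage /= sK.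
have -> // : `[< laminar A B >] =
  `[< laminar (s @^-1` A) (s @^-1` B) >]%classic.
by apply/asbool_equiv_eq; split=> ?; apply/(laminar_preimage _ _ sK).
Qed.

(** * The action of the type A generators on weights *)

Definition strand_act (p q : nat) (f : weight) : weight :=
  reflection (block p q) (pull (flip p q) f).

(** Moving all reflections to the left separates each relation between
generators into a relation of reflections and a relation of permutations. *)
Lemma strand_act_comp p q k l f :
  strand_act p q (strand_act k l f) =
  reflection (block p q) (reflection (flip p q @^-1` block k l)%classic
    (pull (flip p q \o flip k l) f)).
Proof.
have E : (flip p q @^-1` (flip p q @^-1` block k l) = block k l)%classic.
  by apply/funext => i; rewrite /preimage /= flipK.
by rewrite /strand_act -{1}E -(reflection_pull _ _ (flipK p q)).
Qed.

Lemma strand_actK p q : involutive (strand_act p q).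
Proof.
move=> f; rewrite strand_act_comp flip_block_sup // reflectionK.
by rewrite (eq_pull _ (flipK p q)).
Qed.

Lemma strand_actC p q k l f : (p <= q)%N -> (k <= l)%N -> (q.+1 < k)%N ->
  strand_act p q (strand_act k l f) = strand_act k l (strand_act p q f).
Proof.
move=> pq kl qk; rewrite !strand_act_comp !flip_block_disjoint ?qk ?orbT //.
rewrite reflectionC ?(eq_pull _ (flipC _ _ qk)) //.
by apply/laminar_block => //; rewrite qk.
Qed.

Lemma strand_act_flip p q k l f : (p <= k)%N -> (k <= l)%N -> (l <= q)%N ->
  strand_act p q (strand_act k l f) =
  strand_act (p + q - l) (p + q - k) (strand_act p q f).
Proof.
move=> pk kl lq; rewrite !strand_act_comp flip_block_sub //.
rewrite flip_block_sup ?(eq_pull _ (flip_flip pk kl lq)); try lia.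
by apply: reflectionC; apply/laminar_block; lia.
Qed.

Lemma pull_strand_act p q k l f : (p <= k)%N -> (k <= l)%N -> (l <= q)%N ->
  pull (flip p q) (strand_act k l f) =
  strand_act (p + q - l) (p + q - k) (pull (flip p q) f).
Proof.
move=> pk kl lq; rewrite /strand_act -(flip_block_sub pk kl lq).
have E : (flip p q @^-1` (flip p q @^-1` block k l) = block k l)%classic.
  by apply/funext => i; rewrite /preimage /= flipK.
rewrite -{1}E -(reflection_pull _ _ (flipK p q)); congr reflection.
exact: eq_pull f (flip_flip pk kl lq).
Qed.

Lemma strand_act_self p q f :
  strand_act p q f (block p q) = (- f (block p q))%R.
Proof. by rewrite /strand_act reflection_self /pull flip_block_sup. Qed.

Lemma strand_act_laminar p q k l f : (p <= q)%N -> (k <= l)%N ->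
  (k, l) <> (p, q) -> laminar (block p q) (block k l) ->
  strand_act p q f (block k l) = f (flip p q @^-1` block k l)%classic.
Proof.
move=> pq kl neq lam; rewrite /strand_act reflection_laminar //.
by move=> /(eq_block kl pq)[kp lq]; apply: neq; rewrite kp lq.
Qed.

Lemma strand_act_disjoint p q k l f : (p <= q)%N -> (k <= l)%N ->
  (q.+1 < k)%N || (l.+1 < p)%N ->
  strand_act p q f (block k l) = f (block k l).
Proof.
move=> pq kl H; rewrite strand_act_laminar ?flip_block_disjoint //.
  by case; lia.
by apply/laminar_block; lia.
Qed.

Lemma strand_act_sup p q k l f : (p <= q)%N -> (k <= p)%N -> (q <= l)%N ->
  (k < p)%N || (q < l)%N -> strand_act p q f (block k l) = f (block k l).
Proof.
move=> pq kp ql H; rewrite strand_act_laminar ?flip_block_sup //; try lia.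
  by case; lia.
by apply/laminar_block; lia.
Qed.

Lemma strand_act_sub p q k l f : (p <= k)%N -> (k <= l)%N -> (l <= q)%N ->
  (p < k)%N || (l < q)%N ->
  strand_act p q f (block k l) = f (block (p + q - l) (p + q - k)).
Proof.
move=> pk kl lq H; rewrite strand_act_laminar ?flip_block_sub //; try lia.
  by case; lia.
by apply/laminar_block; lia.
Qed.

(** * Positivity on crossing sets *)

(** This weak form of positivity allows negative values, but never on two sets
that cross. The constant weight 1 has it. *)
Definition crossing_positive (f : weight) : Prop :=
  forall A B, ~ laminar A B -> (0 < f A + f B)%R.

(** If [B] crosses [A], the sum of the values on [A] and [B] is unchanged: it
goes from [f A + f B] to [- f A + (f B + 2 f A)]. All the values on sets other
than [A] do not decrease when [f A] is positive. *)
Lemma crossing_positive_reflection A f :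
  crossing_positive f -> (0 < f A)%R -> crossing_positive (reflection A f).
Proof.
move=> fpos fA B C BC; have fBC := fpos _ _ BC.
have [E|BA] := EM (B = A).
  move: BC; rewrite E => lamAC.
  by rewrite reflection_self reflection_crossing // -?E; lia.
have [E|CA] := EM (C = A).
  move: BC; rewrite E => BA'; rewrite reflection_self reflection_crossing.
    by rewrite -?E; lia.
  by move/laminar_sym.
have [AB|AB] := EM (laminar A B); have [lamAC|lamAC] := EM (laminar A C);
  by rewrite ?(reflection_laminar _ BA AB) ?(reflection_laminar _ CA lamAC)
    ?(reflection_crossing _ AB) ?(reflection_crossing _ lamAC); lia.
Qed.

Lemma crossing_positive_strand_act p q f : crossing_positive f ->
  (0 < f (block p q))%R -> crossing_positive (strand_act p q f).
Proof.
move=> fpos fA; apply: crossing_positive_reflection.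
  by move=> A B AB; apply: fpos => /(laminar_preimage _ _ (flipK p q)).
by rewrite /pull flip_block_sup.
Qed.

(** * Symmetric weights and folded generators *)

(** The reversal of all the strands [1, ..., 2n]; it fixes the other integers,
so that it is an involution of [nat]. *)
Definition mirror (n : nat) : nat -> nat := flip 1 (2 * n).-1.

Definition symmetric_weight (n : nat) (f : weight) : Prop :=
  pull (mirror n) f = f.

(** For [q < n] the generator [s_[p,q]] folds onto two mirror blocks, of which
this is the one on the left; symmetric weights take the same value on the
other. *)
Definition sp_block (n p q : nat) : set nat :=
  block p (if (q < n)%N then q else (2 * n - p)%N).

(** The image of [s_[p,q]] under folding, acting on weights. *)
Definition sp_act (n p q : nat) (f : weight) : weight :=
  if (q < n)%N then strand_act p q (strand_act (2 * n - q) (2 * n - p) f)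
  else strand_act p (2 * n - p) f.

Lemma mirror_block n k l : (0 < k)%N -> (k <= l)%N -> (l < 2 * n)%N ->
  (mirror n @^-1` block k l = block (2 * n - l) (2 * n - k))%classic.
Proof.
by move=> k0 kl ln; rewrite /mirror flip_block_sub; try lia;
  congr block; lia.
Qed.

Lemma symmetric_weight_block n k l f : symmetric_weight n f ->
  (0 < k)%N -> (k <= l)%N -> (l < 2 * n)%N ->
  f (block (2 * n - l) (2 * n - k)) = f (block k l).
Proof. by move=> fS *; rewrite -{2}fS /pull mirror_block. Qed.

Lemma symmetric_weight_sp_act n p q f : is_itv n p q ->
  symmetric_weight n f -> symmetric_weight n (sp_act n p q f).
Proof.
rewrite /is_itv /symmetric_weight => pqn fS.
have pull_act k l g : (0 < k)%N -> (k <= l)%N -> (l < 2 * n)%N ->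
    pull (mirror n) (strand_act k l g) =
    strand_act (2 * n - l) (2 * n - k) (pull (mirror n) g).
  by move=> k0 kl ln; rewrite pull_strand_act; try lia;
    congr strand_act; lia.
rewrite /sp_act; case: ifP => qn.
  rewrite !pull_act ?fS; try lia.
  rewrite [RHS]strand_actC; try lia.
  by congr (strand_act _ _ (strand_act _ _ _)); lia.
rewrite pull_act ?fS; try lia.
by congr strand_act; lia.
Qed.

(** For [q < n] two reflections are applied. Symmetry makes the value on the
mirror block positive as well, and the first reflection does not affect the
value on the other block, as the two blocks are disjoint. *)
Lemma crossing_positive_sp_act n p q f : is_itv n p q ->
  symmetric_weight n f -> crossing_positive f -> (0 < f (sp_block n p q))%R ->
  crossing_positive (sp_act n p q f).
Proof.
rewrite /is_itv /sp_act /sp_block => pqn fS fpos.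
case: ifP => qn fA; last exact: crossing_positive_strand_act.
apply: crossing_positive_strand_act.
  apply: crossing_positive_strand_act => //.
  by rewrite symmetric_weight_block //; lia.
by rewrite strand_act_disjoint //; lia.
Qed.

Lemma sp_act_self n p q f : is_itv n p q ->
  sp_act n p q f (sp_block n p q) = (- f (sp_block n p q))%R.
Proof.
rewrite /is_itv /sp_act /sp_block => pqn; case: ifP => qn.
  by rewrite strand_act_self strand_act_disjoint //; lia.
by rewrite strand_act_self.
Qed.

(** * Relations in the cactus groups *)

Lemma to_presented_rel (X : choiceType) (R : word X -> word X -> Prop) u v :
  R u v -> to_presented R u = to_presented R v.
Proof. by move=> Ruv; apply/to_presentedP/word_cong_rel. Qed.

Lemma disconnectedP p q k l : (p <= q)%N -> (k <= l)%N ->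
  disconnected p q k l <-> (q.+1 < k)%N || (l.+1 < p)%N.
Proof.
rewrite /disconnected /adjacent => pq kl; split; last by lia.
(* Intervals that meet share the larger of their left ends; adjacent ones have
   adjacent ends. *)
by move=> H; move: (H (maxn p k) (maxn p k)) (H p l) (H q k); lia.
Qed.

Lemma sp_genK n p q : is_itv n p q -> sp_gen n p q * sp_gen n p q = 1.
Proof.
move=> pq; rewrite [LHS]to_presentedM.
exact/to_presented_rel/sp_square.
Qed.

Lemma sp_genC n p q k l : is_itv n p q -> is_itv n k l ->
  (q.+1 < k)%N || (l.+1 < p)%N ->
  sp_gen n p q * sp_gen n k l = sp_gen n k l * sp_gen n p q.
Proof.
move=> pq kl H; rewrite [LHS]to_presentedM [RHS]to_presentedM.
apply/to_presented_rel/sp_commute => //.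
by move: pq kl; rewrite /is_itv => pq kl; apply/disconnectedP; lia.
Qed.

Lemma sp_gen_central n p k l : is_itv n p n -> (p <= k)%N -> is_itv n k l ->
  sp_gen n p n * sp_gen n k l = sp_gen n k l * sp_gen n p n.
Proof.
rewrite /is_itv => pn pk kl; rewrite [LHS]to_presentedM [RHS]to_presentedM.
by apply/to_presented_rel/sp_central => //; rewrite /is_itv; lia.
Qed.

Lemma sp_gen_flip n p q k l : (0 < p)%N -> (q < n)%N ->
  (p <= k)%N -> (k <= l)%N -> (l <= q)%N ->
  sp_gen n p q * sp_gen n k l =
  sp_gen n (p + q - l) (p + q - k) * sp_gen n p q.
Proof.
move=> p0 qn pk kl lq; rewrite [LHS]to_presentedM [RHS]to_presentedM.
by apply/to_presented_rel/sp_flip => //; rewrite /is_itv; lia.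
Qed.

Lemma sl_genK N p q : is_itv N.-1 p q -> sl_gen N p q * sl_gen N p q = 1.
Proof.
move=> pq; rewrite [LHS]to_presentedM.
exact/to_presented_rel/sl_square.
Qed.

Lemma sl_genC N p q k l : is_itv N.-1 p q -> is_itv N.-1 k l ->
  (q.+1 < k)%N || (l.+1 < p)%N ->
  sl_gen N p q * sl_gen N k l = sl_gen N k l * sl_gen N p q.
Proof.
move=> pq kl H; rewrite [LHS]to_presentedM [RHS]to_presentedM.
apply/to_presented_rel/sl_commute => //.
by move: pq kl; rewrite /is_itv => pq kl; apply/disconnectedP; lia.
Qed.

Lemma sl_gen_flip N p q k l : (0 < p)%N -> (q < N)%N ->
  (p <= k)%N -> (k <= l)%N -> (l <= q)%N ->
  sl_gen N p q * sl_gen N k l =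
  sl_gen N (p + q - l) (p + q - k) * sl_gen N p q.
Proof.
move=> p0 qn pk kl lq; rewrite [LHS]to_presentedM [RHS]to_presentedM.
by apply/to_presented_rel/sl_flip => //; rewrite /is_itv; lia.
Qed.

(** Laminar blocks come from intervals that are disconnected or nested, and for
each of these configurations there is a defining relation. If [[k, l]] lies in
[[p, n]] with [l < n], the reversal of [[p, 2n - p]] sends the left block of
[[k, l]] to its mirror image: there the symmetry of [f] is needed. *)
Lemma sp_exchange n p q k l f : is_itv n p q -> is_itv n k l ->
  symmetric_weight n f -> (k, l) <> (p, q) ->
  laminar (sp_block n p q) (sp_block n k l) ->
  exists k' l' p' q', [/\ is_itv n k' l', is_itv n p' q',
    sp_act n p q f (sp_block n k l) = f (sp_block n k' l') &
    sp_gen n p q * sp_gen n k' l' = sp_gen n k l * sp_gen n p' q'].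
Proof.
move=> pqn kln fS neq.
have {}neq : (k != p) || (l != q).
  rewrite -negb_and; apply/negP => /andP[/eqP kp /eqP lq].
  by apply: neq; rewrite kp lq.
have pqn' := pqn; have kln' := kln; rewrite /is_itv in pqn' kln'.
rewrite /sp_act /sp_block; case: (ltnP q n) => qn; case: (ltnP l n) => ln.
- move/laminar_block => /(_ ltac:(lia) ltac:(lia))/or4P[] H.
  + exists k, l, p, q; rewrite ln !strand_act_disjoint; try lia.
    by split=> //; apply: sp_genC; rewrite ?H.
  + exists k, l, p, q; rewrite ln !strand_act_disjoint; try lia.
    by split=> //; apply: sp_genC; rewrite ?H ?orbT.
  + exists k, l, (k + l - q)%N, (k + l - p)%N.
    rewrite ln strand_act_sup ?strand_act_disjoint; try lia.
    split=> //; first by rewrite /is_itv; lia.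
    by rewrite [RHS]sp_gen_flip; try lia; congr (sp_gen _ _ _ * _); lia.
  + exists (p + q - l)%N, (p + q - k)%N, p, q.
    have -> : (p + q - k < n)%N by lia.
    rewrite strand_act_sub ?strand_act_disjoint; try lia.
    split=> //; first by rewrite /is_itv; lia.
    by rewrite sp_gen_flip; try lia; congr (sp_gen _ _ _ * _); lia.
- have El : l = n by lia.
  rewrite {}El in kln kln' ln neq *.
  move/laminar_block => /(_ ltac:(lia) ltac:(lia))/or4P[] H; try lia;
    exists k, n, p, q; rewrite ltnn.
  + rewrite !strand_act_disjoint; try lia.
    by split=> //; apply: sp_genC => //; lia.
  + rewrite !strand_act_sup; try lia.
    by split=> //; rewrite -sp_gen_central //; lia.
(* The reversal attached to (p, n) moves the left block of (k, l) to its mirror image. *)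
- have Eq : q = n by lia.
  rewrite {}Eq in pqn pqn' qn neq *.
  move/laminar_block => /(_ ltac:(lia) ltac:(lia))/or4P[] H; try lia;
    exists k, l, p, n; rewrite ln.
  + rewrite !strand_act_disjoint; try lia.
    by split=> //; apply: sp_genC => //; lia.
  + rewrite strand_act_sub; try lia.
    split=> //; last by rewrite sp_gen_central //; lia.
    rewrite -(symmetric_weight_block fS (k := k) (l := l)); try lia.
    by congr (f (block _ _)); lia.
- have Eq : q = n by lia.
  have El : l = n by lia.
  rewrite {}Eq {}El in pqn pqn' kln kln' neq qn ln * => _.
  exists k, n, p, n; rewrite ltnn.
  have [pk|kp] := leqP p k.
    rewrite strand_act_sub; try lia.
    split=> //; last exact: sp_gen_central.
    by congr (f (block _ _)); lia.
  rewrite strand_act_sup; try lia.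
  by split=> //; rewrite -sp_gen_central //; lia.
Qed.

(** * Actions of the cactus groups *)

Lemma s_wordE n (x : itv n) : s_word n (val x).1 (val x).2 = [:: (x, false)].
Proof. by rewrite /s_word -surjective_pairing valK. Qed.

Definition letter_act (m : nat) (S : Type) (act : nat -> nat -> S -> S)
    (x : itv m) : S -> S :=
  act (val x).1 (val x).2.

Lemma word_act_s_word (m : nat) (S : Type) (act : nat -> nat -> S -> S) p q s :
  is_itv m p q ->
  word_act (letter_act act) (s_word m p q) s
  = act p q s.
Proof. by move=> pq; rewrite /s_word insubT. Qed.

Lemma letter_actK (m : nat) (S : Type) (act : nat -> nat -> S -> S) :
  (forall p q, is_itv m p q -> involutive (act p q)) ->
  forall x : itv m, involutive (letter_act act x).
Proof. by move=> actK x; apply: actK; apply: (valP x). Qed.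

(** The universal property of the symplectic presentation, for actions by
involutions. Commutation is only asked in one order of the two intervals. *)
Lemma sp_rel_act n (S : Type) (act : nat -> nat -> S -> S) :
  (forall p q, is_itv n p q -> involutive (act p q)) ->
  (forall p q k l, is_itv n p q -> is_itv n k l -> (q.+1 < k)%N ->
     act p q \o act k l =1 act k l \o act p q) ->
  (forall p k l, (0 < p)%N -> (p <= k)%N -> (k <= l)%N -> (l <= n)%N ->
     act p n \o act k l =1 act k l \o act p n) ->
  (forall p q k l, (0 < p)%N -> (q < n)%N ->
     (p <= k)%N -> (k <= l)%N -> (l <= q)%N ->
     act p q \o act k l =1 act (p + q - l) (p + q - k) \o act p q) ->
  forall u v : word (itv n), sp_rel u v ->
    word_act (letter_act act) u =1 word_act (letter_act act) v.
Proof.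
move=> actK actC actZ actF u v; case.
- by move=> p q pq s; rewrite word_act_cat !word_act_s_word // actK.
- move=> p q k l pq kl dis s; rewrite !word_act_cat !word_act_s_word //.
  have /orP[H|H] : (q.+1 < k)%N || (l.+1 < p)%N.
  + by apply/disconnectedP => //; move: pq kl; rewrite /is_itv; lia.
  + exact: actC.
  + by apply/esym; apply: actC.
- move=> p k l pn /and3P[pk kl ln] s.
  have kln : is_itv n k l by move: pn; rewrite /is_itv; lia.
  rewrite !word_act_cat !word_act_s_word //.
  by apply: actZ => //; move: pn; rewrite /is_itv; lia.
- move=> p q k l pq /and3P[pk kl lq] s; rewrite /is_itv in pq.
  rewrite !word_act_cat !word_act_s_word /is_itv; try lia.
  by apply: actF => //; lia.
Qed.

Lemma sl_rel_act m (S : Type) (act : nat -> nat -> S -> S) :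
  (forall p q, is_itv m p q -> involutive (act p q)) ->
  (forall p q k l, is_itv m p q -> is_itv m k l -> (q.+1 < k)%N ->
     act p q \o act k l =1 act k l \o act p q) ->
  (forall p q k l, (0 < p)%N -> (q <= m)%N ->
     (p <= k)%N -> (k <= l)%N -> (l <= q)%N ->
     act p q \o act k l =1 act (p + q - l) (p + q - k) \o act p q) ->
  forall u v : word (itv m), sl_rel u v ->
    word_act (letter_act act) u =1 word_act (letter_act act) v.
Proof.
move=> actK actC actF u v; case.
- by move=> p q pq s; rewrite word_act_cat !word_act_s_word // actK.
- move=> p q k l pq kl dis s; rewrite !word_act_cat !word_act_s_word //.
  have /orP[H|H] : (q.+1 < k)%N || (l.+1 < p)%N.
  + by apply/disconnectedP => //; move: pq kl; rewrite /is_itv; lia.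
  + exact: actC.
  + by apply/esym; apply: actC.
- move=> p q k l pq /and3P[pk kl lq] s; rewrite /is_itv in pq.
  rewrite !word_act_cat !word_act_s_word /is_itv; try lia.
  by apply: actF => //; lia.
Qed.

Lemma strand_act_rel m (u v : word (itv m)) : sl_rel u v ->
  word_act (letter_act strand_act) u =1 word_act (letter_act strand_act) v.
Proof.
apply: sl_rel_act.
- by move=> p q _; apply: strand_actK.
- by move=> p q k l; rewrite /is_itv => pq kl qk f; apply: strand_actC; lia.
- by move=> p q k l p0 qm pk kl lq f; apply: strand_act_flip.
Qed.

Definition sl_act (N : nat) : cactus_sl N -> weight -> weight :=
  presented_act (letter_act strand_act).

Lemma sl_actM N (g h : cactus_sl N) f :
  sl_act (g * h) f = sl_act g (sl_act h f).
Proof.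
apply: presented_actM => [x|]; last exact: strand_act_rel.
exact: strand_actK.
Qed.

Lemma sl_act1 N f : sl_act (1 : cactus_sl N) f = f.
Proof.
apply: (@presented_actE _ _ _ _ _ (@strand_act_rel N.-1) [::]) => x.
exact: strand_actK.
Qed.

Lemma sl_act_gen N p q f : is_itv N.-1 p q ->
  sl_act (sl_gen N p q) f = strand_act p q f.
Proof.
move=> pq; rewrite /sl_act presented_actE ?word_act_s_word // => [x|].
  exact: strand_actK.
exact: strand_act_rel.
Qed.

(** * The folding homomorphism *)

Definition fold_gen (n p q : nat) : cactus_sl (2 * n) :=
  if (q < n)%N
  then sl_gen (2 * n) p q * sl_gen (2 * n) (2 * n - q) (2 * n - p)
  else sl_gen (2 * n) p (2 * n - p).

Lemma sl_itv n p q : (0 < p)%N -> (p <= q)%N -> (q < 2 * n)%N ->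
  is_itv (2 * n).-1 p q.
Proof. by rewrite /is_itv; lia. Qed.

Lemma mulg_swap (G : groupType) (a b c d : G) : b * c = c * b ->
  (a * b) * (c * d) = (a * c) * (b * d).
Proof. by move=> bc; rewrite !mulgA -(mulgA a b c) bc !mulgA. Qed.

Lemma fold_genK n p q : is_itv n p q -> fold_gen n p q * fold_gen n p q = 1.
Proof.
rewrite /is_itv /fold_gen => pq; case: ifP => qn; last first.
  by rewrite sl_genK //; apply: sl_itv; lia.
rewrite mulg_swap; last by rewrite sl_genC //; try apply: sl_itv; lia.
by rewrite !sl_genK ?mulg1 //; apply: sl_itv; lia.
Qed.

Lemma fold_genC n p q k l : is_itv n p q -> is_itv n k l -> (q.+1 < k)%N ->
  fold_gen n p q * fold_gen n k l = fold_gen n k l * fold_gen n p q.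
Proof.
rewrite /is_itv /fold_gen => pq kl qk; have -> : (q < n)%N by lia.
have comm a b c d : (0 < a)%N -> (a <= b)%N -> (b.+1 < c)%N -> (c <= d)%N ->
    (d < 2 * n)%N -> commute (sl_gen (2 * n) a b) (sl_gen (2 * n) c d).
  by move=> *; apply: sl_genC; try apply: sl_itv; lia.
case: ifP => ln; apply: commute_sym; last first.
  by apply: commuteM; [apply: commute_sym|]; apply: comm; lia.
by apply: commuteM; apply: commute_sym; apply: commuteM;
  first [by apply: comm; lia | by apply: commute_sym; apply: comm; lia].
Qed.

(** For [l < n] the reversal of [[p, 2n - p]] exchanges the two mirror factors
of the image of [s_[k,l]], and these factors commute. *)
Lemma fold_gen_central n p k l : (0 < p)%N -> (p <= k)%N -> (k <= l)%N ->
  (l <= n)%N ->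
  fold_gen n p n * fold_gen n k l = fold_gen n k l * fold_gen n p n.
Proof.
move=> p0 pk kl ln; rewrite /fold_gen ltnn; case: ifP => ln'.
  have conj a b : (p <= a)%N -> (a <= b)%N -> (b <= 2 * n - p)%N ->
      sl_gen (2 * n) p (2 * n - p) * sl_gen (2 * n) a b =
      sl_gen (2 * n) (2 * n - b) (2 * n - a) * sl_gen (2 * n) p (2 * n - p).
    move=> pa ab bn; rewrite sl_gen_flip; try lia.
    by congr (sl_gen _ _ _ * _); lia.
  rewrite mulgA conj; try lia.
  rewrite -(mulgA (sl_gen _ _ _)) conj; try lia.
  rewrite mulgA !subKn; try lia.
  by congr (_ * _); rewrite sl_genC //; try apply: sl_itv; lia.
rewrite sl_gen_flip; try lia.
by congr (sl_gen _ _ _ * _); lia.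
Qed.

Lemma fold_gen_flip n p q k l : (0 < p)%N -> (q < n)%N ->
  (p <= k)%N -> (k <= l)%N -> (l <= q)%N ->
  fold_gen n p q * fold_gen n k l =
  fold_gen n (p + q - l) (p + q - k) * fold_gen n p q.
Proof.
move=> p0 qn pk kl lq; rewrite /fold_gen qn.
have -> : (l < n)%N by lia.
have -> : (p + q - k < n)%N by lia.
rewrite mulg_swap; last by rewrite sl_genC //; try apply: sl_itv; lia.
rewrite sl_gen_flip; try lia.
rewrite [X in _ * X = _]sl_gen_flip; try lia.
have -> : (2 * n - q + (2 * n - p) - (2 * n - k) = 2 * n - (p + q - k))%N.
  by lia.
have -> : (2 * n - q + (2 * n - p) - (2 * n - l) = 2 * n - (p + q - l))%N.
  by lia.
by apply: mulg_swap; rewrite sl_genC //; try apply: sl_itv; lia.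
Qed.

Definition fold_act (n p q : nat) (h : cactus_sl (2 * n)) : cactus_sl (2 * n) :=
  fold_gen n p q * h.

Lemma fold_actK n p q : is_itv n p q -> involutive (@fold_act n p q).
Proof. by move=> pq h; rewrite /fold_act mulgA fold_genK // mul1g. Qed.

Lemma fold_act_rel n (u v : word (itv n)) : sp_rel u v ->
  word_act (letter_act (@fold_act n)) u =1
  word_act (letter_act (@fold_act n)) v.
Proof.
apply: sp_rel_act; first exact: fold_actK.
- by move=> p q k l pq kl qk h; rewrite /= /fold_act !mulgA fold_genC.
- by move=> p k l *h; rewrite /= /fold_act !mulgA fold_gen_central.
- by move=> p q k l *h; rewrite /= /fold_act !mulgA fold_gen_flip.
Qed.

(** The image of [g] is read off the action of the symplectic group on the
target by left multiplications: it is where [g] sends the unit. *)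
Definition fold_hom (n : nat) (g : cactus_sp n) : cactus_sl (2 * n) :=
  presented_act (letter_act (@fold_act n)) g 1.

Lemma fold_hom_act n (g : cactus_sp n) h :
  presented_act (letter_act (@fold_act n)) g h = fold_hom g * h.
Proof.
rewrite /fold_hom /presented_act; elim: (repr g) => [|a u IHu] /=.
  by rewrite mul1g.
by rewrite IHu /letter_act /fold_act mulgA.
Qed.

Lemma fold_hom_is_morphism n : monoid_morphism (@fold_hom n).
Proof.
have actK := letter_actK (@fold_actK n).
split=> [|g h]; first exact: (presented_actE actK (@fold_act_rel n) [::]).
by rewrite /fold_hom (presented_actM actK (@fold_act_rel n)) fold_hom_act.
Qed.

HB.instance Definition _ (n : nat) :=
  isUMagmaMorphism.Build (cactus_sp n) (cactus_sl (2 * n)) (@fold_hom n)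
    (@fold_hom_is_morphism n).

Lemma fold_hom_gen n p q : is_itv n p q ->
  fold_hom (sp_gen n p q) = fold_gen n p q.
Proof.
move=> pq; rewrite /fold_hom.
rewrite (presented_actE (letter_actK (@fold_actK n)) (@fold_act_rel n)).
by rewrite word_act_s_word // /fold_act mulg1.
Qed.

Lemma sl_act_fold_gen n p q f : is_itv n p q ->
  sl_act (fold_gen n p q) f = sp_act n p q f.
Proof.
rewrite /is_itv /fold_gen /sp_act => pq; case: ifP => qn.
  by rewrite sl_actM !sl_act_gen //; apply: sl_itv; lia.
by rewrite sl_act_gen //; apply: sl_itv; lia.
Qed.

(** * Shortest words and descents *)

Definition sp_prod (n : nat) (w : seq (itv n)) : cactus_sp n :=
  \prod_(x <- w) sp_gen n (val x).1 (val x).2.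

Definition sp_weight (n : nat) (w : seq (itv n)) : weight :=
  foldr (fun x => sp_act n (val x).1 (val x).2) (fun=> 1%R) w.

(** This relates the kernel to descents: a word for an element of the kernel
gives back the constant weight. *)
Lemma sl_act_sp_prod n (w : seq (itv n)) :
  sl_act (fold_hom (sp_prod w)) (fun=> 1%R) = sp_weight w.
Proof.
have [fold1 foldM] := @fold_hom_is_morphism n.
rewrite /sp_prod; elim: w => [|x w IHw].
  by rewrite big_nil fold1 sl_act1.
rewrite big_cons foldM sl_actM IHw fold_hom_gen; last exact: (valP x).
by rewrite sl_act_fold_gen; last exact: (valP x).
Qed.

Lemma sp_prod_surj n (g : cactus_sp n) : exists w, sp_prod w = g.
Proof.
rewrite -(reprK_presented g); elim: (repr g) => [|[x b] u [w Ew]].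
  by exists [::]; rewrite /sp_prod big_nil.
(* The inverse of a generator is the generator itself. *)
have Ex : to_presented (@sp_rel n) [:: (x, b)] = sp_gen n (val x).1 (val x).2.
  rewrite /sp_gen s_wordE; case: b => //.
  apply: (@mulgI _ (sp_gen n (val x).1 (val x).2)).
  rewrite {2}/sp_gen -s_wordE sp_genK; last exact: (valP x).
  rewrite /sp_gen s_wordE [LHS]to_presentedM.
  by apply/to_presentedP; apply: word_cong_cancel.
exists (x :: w); rewrite /sp_prod big_cons -/(sp_prod w) Ew -Ex.
exact: to_presentedM.
Qed.

Definition reduced (n : nat) (w : seq (itv n)) : Prop :=
  forall v, sp_prod v = sp_prod w -> (size w <= size v)%N.

Lemma reduced_surj n (g : cactus_sp n) :
  exists2 w, sp_prod w = g & reduced w.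
Proof.
have ex : exists k, `[< exists w, sp_prod w = g /\ size w = k >].
  by have [w Ew] := sp_prod_surj g; exists (size w); apply/asboolP; exists w.
case: (ex_minnP ex) => k /asboolP[w [Ew wk]] kmin.
exists w => // v Ev; rewrite wk; apply: kmin; apply/asboolP; exists v.
by rewrite Ev.
Qed.

Lemma sp_prod_cons n p q (w : seq (itv n)) (pq : is_itv n p q) :
  sp_prod (Sub (p, q) pq :: w) = sp_gen n p q * sp_prod w.
Proof. by rewrite /sp_prod big_cons SubK. Qed.

Lemma reduced_behead n x (w : seq (itv n)) : reduced (x :: w) -> reduced w.
Proof.
move=> redw v Ev; have := redw (x :: v).
by rewrite /sp_prod !big_cons -!/(sp_prod _) Ev => /(_ erefl).
Qed.

(** Nonpositive values of the weight detect the letters that a shortest word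
can begin with, just as negative coordinates detect descents in Coxeter groups.
*)
Definition descent_property (n : nat) (w : seq (itv n)) : Prop :=
  forall k l, is_itv n k l -> (sp_weight w (sp_block n k l) <= 0)%R ->
    exists2 v, sp_prod w = sp_gen n k l * sp_prod v & size w = (size v).+1.

(** Otherwise the descent property would make [w] begin with [s_[p,q]], and the
two adjacent equal letters would cancel, against minimality. *)
Lemma reduced_positive n p q (pq : is_itv n p q) (w : seq (itv n)) :
  reduced (Sub (p, q) pq :: w) -> descent_property w ->
  (0 < sp_weight w (sp_block n p q))%R.
Proof.
move=> redw desc; rewrite Order.TotalTheory.ltNge; apply/negP.
move=> /(desc _ _ pq)[v Ev szv].
have := redw v; rewrite sp_prod_cons Ev mulgA sp_genK // mul1g => /(_ erefl).
by rewrite /= szv; lia.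
Qed.

Lemma reduced_weight n (w : seq (itv n)) : reduced w ->
  [/\ symmetric_weight n (sp_weight w), crossing_positive (sp_weight w)
    & descent_property w].
Proof.
elim: w => [|x w IHw] redw; first by split.
have [fS fpos desc] := IHw (reduced_behead redw).
case: x redw => -[p q] /= pq redw.
have fA := reduced_positive redw desc.
split.
- exact: symmetric_weight_sp_act.
- exact: crossing_positive_sp_act.
move=> k l kl; rewrite sp_prod_cons /= -/(sp_weight w) => gB.
have [[-> ->]|neq] := EM ((k, l) = (p, q)); first by exists w.
have [lam|cross] := EM (laminar (sp_block n p q) (sp_block n k l)); last first.
  (* The value on the block of (p, q) has become negative, so that no crossing
     block can carry a nonpositive value. *)
  have := crossing_positive_sp_act pq fS fpos fA cross.
  by rewrite sp_act_self //; lia.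
have [k' [l' [p' [q' [kl' pq' Ef Eg]]]]] := sp_exchange pq kl fS neq lam.
move: gB; rewrite Ef => /(desc _ _ kl')[v Ev szv].
exists (Sub (p', q') pq' :: v); last by rewrite /= szv.
by rewrite sp_prod_cons Ev !mulgA Eg.
Qed.

Lemma fold_hom_inj n : injective (@fold_hom n).
Proof.
apply: gmulf_inj => g; have [w <- redw] := reduced_surj g.
case: w redw => [|[[p q] /= pq] w] redw Ew; first by rewrite /sp_prod big_nil.
have [_ _ desc] := reduced_weight (reduced_behead redw).
have := reduced_positive redw desc.
have := congr1 (fun f : weight => f (sp_block n p q))
  (sl_act_sp_prod (Sub (p, q) pq :: w)).
by rewrite /= -/(sp_weight w) sp_act_self // Ew sl_act1; lia.
Qed.

Theorem lemma4 (n : nat) (n_ge1 : (1 <= n)%N) :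
  exists Gamma : UMagmaMorphism.type (cactus_sp n) (cactus_sl (2 * n)),
    [/\ forall p q : nat, (1 <= p)%N -> (p <= q)%N -> (q < n)%N ->
          Gamma (sp_gen n p q)
          = sl_gen (2 * n) p q * sl_gen (2 * n) (2 * n - q) (2 * n - p),
        forall p : nat, (1 <= p)%N -> (p <= n)%N ->
          Gamma (sp_gen n p n) = sl_gen (2 * n) p (2 * n - p)
      & injective Gamma].
Proof.
exists (@fold_hom n : UMagmaMorphism.type _ _); split.
- move=> p q p0 pq qn; rewrite /= fold_hom_gen /fold_gen ?qn //.
  by rewrite /is_itv; lia.
- move=> p p0 pn; rewrite /= fold_hom_gen /fold_gen ?ltnn //.
  by rewrite /is_itv; lia.
- exact: fold_hom_inj.
Qed.
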